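(* Let $G$ be a finite group and $p$ a prime divisor of $|G|$ with $(|G|,p-1)=1$. Then $G$ is $p$-nilpotent if and only if $G$ has a soluble normal subgroup $H$ such that $G/H$ is $p$-nilpotent and every maximal subgroup of every Sylow subgroup of $F(H)$ is $\mathfrak{U}_{\mathrm s}$-quasinormal in $G$, where $\mathfrak{U}$ is the class of all finite supersoluble groups.
   Context: All groups are finite; $(a,b)$ denotes the greatest common divisor and $F(H)$ the Fitting subgroup of $H$. ''Every Sylow subgroup'' means Sylow subgroups for all primes. A subgroup $H$ of $G$ is $s$-permutable in $G$ if $HQ=QH$ for every Sylow subgroup $Q$ of $G$ (for every prime). $H_G$ denotes the largest normal subgroup of $G$ contained in $H$. A chief factor $H/K$ of $G$ is $\mathfrak{U}$-central if the semidirect product $[H/K](G/C_G(H/K))$ (with $G/C_G(H/K)$ acting on $H/K$ by conjugation) belongs to $\mathfrak{U}$. The $\mathfrak{U}$-hypercenter $Z_\infty^{\mathfrak{U}}(G)$ is the product of all normal subgroups $N$ of $G$ such that every $G$-chief factor of $N$ (i.e. every chief factor of $G$ below $N$) is $\mathfrak{U}$-central. A subgroup $H$ of $G$ is $\mathfrak{U}_{\mathrm s}$-quasinormal in $G$ if there exists a normal subgroup $T$ of $G$ such that $HT$ is $s$-permutable in $G$ and $(H\cap T)H_G/H_G\leq Z_\infty^{\mathfrak{U}}(G/H_G)$. *)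

(* Defs.v *)
From mathcomp Require Import all_boot all_fingroup all_solvable.

Set Implicit Arguments.
Unset Strict Implicit.
Unset Printing Implicit Defensive.

Import GroupScope.

(* p-nilpotence: existence of a normal p-complement. *)
Definition p_nilpotent (gT : finGroupType) (p : nat) (G : {set gT}) : bool :=
  [exists K : {group gT}, (K <| G) && p^'.-Hall(G) K].

(* By connectP, G is supersoluble iff there is a series 1 = G_0 <= ... <= G_n = G
   of normal subgroups of G with all quotients G_(i+1) / G_i cyclic. *)
Definition supersoluble (gT : finGroupType) (G : {group gT}) : bool :=
  connect [rel A B : {group gT} |
             [&& A <| G, B <| G, A \subset B & cyclic (B / A)]] 1%G G.

Section UCentral.

Variables (gT : finGroupType) (G H K : {group gT}).

(* C_G(H / K), a subgroup of G containing K. *)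
Definition cent_factor : {group gT} := 'C_G(H / K | 'Q)%G.

(* The conjugation action of 'N(K) / C_G(H / K) on the subgroup of 'N(K) / K
   centralised by C_G(H / K) (which contains H / K); see factor_actE. *)
Definition factor_act := (('J / K) %% cent_factor)%gact.

(* [H / K](G / C_G(H / K)), realised inside the external semidirect product
   defined by factor_act; see factor_sdprodE. *)
Definition factor_sdprod : {group sdprod_by factor_act} :=
  (sdpair1 factor_act @* (H / K) <*>
   sdpair2 factor_act @* (G / cent_factor))%G.

Definition U_central : bool := supersoluble factor_sdprod.

Hypotheses (nsKG : K <| G) (nsHG : H <| G).

Lemma factor_actE x g : x \in H -> g \in G ->
  factor_act (coset K x) (coset cent_factor g) = coset K (x ^ g).
Proof.
move=> Hx Gg; have nKG := normal_norm nsKG; have nHG := normal_norm nsHG.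
have nKg := subsetP nKG g Gg.
have nKx := subsetP nKG x (subsetP (normal_sub nsHG) x Hx).
rewrite /= modactE /=.
- by rewrite qactJ nKg -morphJ.
- by rewrite dom_qactJ.
- rewrite (subsetP _ g Gg) // normsI ?normG //.
  apply: subset_trans (_ : 'N(H / K | 'Q) \subset _); first exact: actsQ.
  exact: astab_norm.
apply/afixP=> c; rewrite !inE => /and4P[_ _ _ /subsetP/(_ (coset K x))].
by rewrite mem_quotient // inE => /(_ isT)/eqP.
Qed.

Lemma factor_sub_range : H / K \subset 'C_(|('J / K)%gact)(cent_factor).
Proof.
rewrite gacentQ centsC /=.
by have:= subsetIr G 'C(H / K | 'Q); rewrite sub_astabQ => /andP[].
Qed.

Lemma factor_sub_dom : G / cent_factor \subset qact_dom 'J K / cent_factor.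
Proof. by rewrite quotientS // dom_qactJ normal_norm. Qed.

Lemma factor_sdprodE :
  [/\ sdpair1 factor_act @* (H / K) ><| sdpair2 factor_act @* (G / cent_factor)
        = factor_sdprod,
      isom (H / K) (sdpair1 factor_act @* (H / K)) (sdpair1 factor_act)
    & isom (G / cent_factor) (sdpair2 factor_act @* (G / cent_factor))
        (sdpair2 factor_act)].
Proof.
split; last 2 first.
- by apply: (sub_isom factor_sub_range); rewrite ?injm_sdpair1.
- by apply: (sub_isom factor_sub_dom); rewrite ?injm_sdpair2.
rewrite sdprodEY //; last first.
  apply/trivgP; rewrite -(im_sdpair_TI factor_act).
  apply: setISS; apply: morphimS; first exact: factor_sub_range.
  exact: factor_sub_dom.
rewrite -actsEsd; [|exact: factor_sub_dom|exact: factor_sub_range].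
apply/subsetP=> a aG; have := subsetP factor_sub_dom _ aG => Da.
rewrite !inE Da; apply/subsetP=> y; rewrite inE.
case/morphimP: aG => g _ Gg ->; case/morphimP=> x _ Hx ->.
rewrite factor_actE // mem_quotient // memJ_norm //.
exact: subsetP (normal_norm nsHG) g Gg.
Qed.

End UCentral.

(* In mathcomp, [chief_factor G K H] says that H / K is a chief factor of G. *)
Definition U_hypercentral (gT : finGroupType) (G N : {group gT}) : bool :=
  [forall K : {group gT}, forall H : {group gT},
     chief_factor G K H && (H \subset N) ==> U_central G H K].

(* The big product of {group gT} is the generated subgroup; for a family of
   normal subgroups it is their set-theoretic product. *)
Definition U_hypercenter (gT : finGroupType) (G : {group gT}) : {group gT} :=
  (\prod_(N : {group gT} | (N <| G) && U_hypercentral G N) N)%G.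

Definition s_permutable (gT : finGroupType) (A G : {set gT}) : Prop :=
  A \subset G /\
  forall (q : nat) (Q : {group gT}),
    prime q -> q.-Sylow(G) Q -> A * Q = Q * A.

Definition Us_quasinormal (gT : finGroupType) (H G : {group gT}) : Prop :=
  H \subset G /\
  exists T : {group gT},
    [/\ T <| G,
        s_permutable (H * T) G
      & ((H :&: T) * gcore H G) / gcore H G
          \subset U_hypercenter (G / gcore H G)].

(* Main.v *)
Require Import Defs.
From mathcomp Require Import all_boot all_fingroup all_solvable.
Set Implicit Arguments.
Unset Strict Implicit.
Unset Printing Implicit Defensive.
Import GroupScope.

(** For the direct implication take H = 1: then 'F(H) is trivial and has no
    maximal subgroup. The converse rests on two ideas.

    The first is a property of a normal q-subgroup P of G all of whose maximal
    subgroups are U_s-quasinormal: an element g of G of order prime to q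
    centralises P as soon as it centralises every section of order q between
    normal subgroups of G ([Us_quasinormal_coprime_cent]). By coprime action
    it is enough to get [P, g] inside 'Phi(P). If this fails, let N be maximal
    among the normal subgroups of G between 'Phi(P) and P that do not contain
    [P, g], and let N0 / N be a chief factor of G below P / N. Maximality makes
    N0 / N the only minimal G-invariant subgroup of P / N, and then a single
    well-chosen maximal subgroup of P shows that it has order q
    ([unique_minnormal_index]). So g centralises P / N0 and N0 / N, hence P / N,
    a contradiction.

    The second idea converts this into p-nilpotence. Apply the property to the
    subgroups 'O_q(H). Since the automorphism group of a group of order q is
    abelian of order q - 1, the elements of the derived group of G centralise
    the sections of order q; therefore the q'-elements of H :&: G^`(1)
    centralise 'O_q(H), for every prime q, and H being soluble this forces
    H :&: G^`(1) into 'F(H) ([sub_Fitting_cent_pcore]). So H / 'F(H) is central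
    in G / 'F(H). For q = p the coprimality of #|G| and p - 1 makes all of G
    centralise the sections of order p, so that the p'-elements of G centralise
    the Sylow p-subgroup 'O_p(H) of 'F(H). Both facts allow p-nilpotence to be
    lifted, from G / H to G / 'F(H) and then to G
    ([p_nilpotent_nilpotent_ext]). *)

(** * Sylow covers, the Fitting subgroup and coprime action *)

Lemma group_eq_Sylow_sub (gT : finGroupType) (A G : {group gT}) :
    A \subset G ->
    (forall r, prime r -> exists2 R : {group gT}, r.-Sylow(G) R & R \subset A) ->
  A :=: G.
Proof.
move=> sAG sylA; apply/eqP; rewrite eqEcard sAG dvdn_leq //.
apply/dvdn_partP=> // r; rewrite mem_primes => /andP[r_pr _].
by have [R sylR sRA] := sylA r r_pr; rewrite -(card_Hall sylR) cardSg.
Qed.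

(** G / 'Z(G) is a quotient of G / A. *)
Lemma nilpotent_central_ext (gT : finGroupType) (A G : {group gT}) :
  A \subset 'Z(G) -> nilpotent (G / A) -> nilpotent G.
Proof.
move=> sAZ nilGA; rewrite -quotient_center_nil.
have nsAG: A <| G by rewrite sub_center_normal.
rewrite -(isog_nil (third_isog sAZ nsAG (center_normal G))).
exact: quotient_nil.
Qed.

(** With C the centraliser, 'F(C) lies in 'F(H), hence in the centre of C.
    A nilpotent normal subgroup of C / 'Z(C) pulls back to a nilpotent one of
    C, so to a subgroup of 'Z(C); thus the soluble group C / 'Z(C) has trivial
    Fitting subgroup and C is abelian. *)
Lemma subcent_Fitting (gT : finGroupType) (H : {group gT}) :
  solvable H -> 'C_H('F(H)) \subset 'F(H).
Proof.
move=> solH; set C := ('C_H('F(H)))%G.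
have nsCH: C <| H.
  by rewrite /= -{3}(setIidPl (normal_norm (Fitting_normal H))) subcent_normal.
have solC: solvable C by apply: solvableS solH; apply: normal_sub.
have sFZ: 'F(C) \subset 'Z(C).
  rewrite subsetI Fitting_sub centsC subIset //.
  rewrite (_ : 'C('F(H)) \subset _) ?orbT // centS //.
  by rewrite Fitting_max ?Fitting_nil // gFnormal_trans.
suff /trivgP/eqP: 'F(C / 'Z(C)) \subset [1].
  rewrite trivg_Fitting ?quotient_sol // -subG1 quotient_sub1 ?gFnorm // => sCZ.
  apply: Fitting_max nsCH (abelian_nil _).
  exact: subset_trans sCZ (subsetIr _ _).
have [E defE sZE nsEC] := inv_quotientN (center_normal _) (Fitting_normal (C / 'Z(C))).
rewrite defE quotient_sub1; last by rewrite (subset_trans (normal_sub nsEC)) ?gFnorm.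
apply: (subset_trans _ sFZ); apply: (Fitting_max nsEC).
apply: (@nilpotent_central_ext _ 'Z(C)); last by rewrite /= -defE Fitting_nil.
rewrite subsetI sZE; apply: subset_trans (subsetIr _ _) _.
exact: centS (normal_sub nsEC).
Qed.

(** Under a coprime action fixed points lift: 'C_P(A) covers P / N when A acts
    trivially on it. This turns statements about commutators into
    factorisations of P. *)
Lemma coprime_comm_mulG_cent (gT : finGroupType) (A P N : {group gT}) :
    A \subset 'N(P) -> coprime #|P| #|A| -> solvable P ->
    N <| P -> A \subset 'N(N) -> [~: P, A] \subset N ->
  'C_P(A) * N = P.
Proof.
move=> nPA coPA solP /andP[sNP nNP] nNA cPNA.
apply/eqP; rewrite eqEsubset mulG_subG subsetIl sNP /=.
rewrite normC ?subIset ?nNP // -quotientSK // coprime_norm_quotient_cent //; last first.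
- exact: solvableS solP.
- exact: coprimeSg coPA.
by rewrite subsetI subxx quotient_cents2r.
Qed.

(** 'C_P(A) covers P / 'Phi(P), and 'Phi(P) consists of non-generators. *)
Lemma coprime_cent_Phi (gT : finGroupType) (A P : {group gT}) :
    A \subset 'N(P) -> coprime #|P| #|A| -> solvable P ->
  [~: P, A] \subset 'Phi(P) -> A \subset 'C(P).
Proof.
move=> nPA coPA solP cPA; have nPhiA: A \subset 'N('Phi(P)) by rewrite gFnorm_trans.
have defP := coprime_comm_mulG_cent nPA coPA solP (Phi_normal P) nPhiA cPA.
rewrite centsC; apply/setIidPl; rewrite -[RHS](@Phi_nongen _ P 'C_P(A)) ?genGid //.
by rewrite joingC norm_joinEl ?defP // (subset_trans (subsetIl _ _)) ?gFnorm.
Qed.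

Lemma coprime_comm_trans (gT : finGroupType) (A P N0 N : {group gT}) :
    A \subset 'N(P) -> coprime #|P| #|A| -> solvable P -> N0 <| P -> A \subset 'N(N0) -> N <| P -> A \subset 'N(N) -> N \subset N0 ->
    [~: P, A] \subset N0 -> [~: N0, A] \subset N ->
  [~: P, A] \subset N.
Proof.
move=> nPA coPA solP nsN0P nN0A nsNP nNA sNN0 cPA cN0A.
have defP := coprime_comm_mulG_cent nPA coPA solP nsN0P nN0A cPA.
have nN: forall B : {group gT}, B \subset P -> B \subset 'N(N).
  by move=> B sBP; apply: subset_trans sBP (normal_norm nsNP).
rewrite -quotient_cents2 ?(normal_norm nsNP) // -defP quotientMl; last first.
  by rewrite nN ?subsetIl.
rewrite mul_subG //; last by rewrite quotient_cents2r.
rewrite quotient_cents2r // (subset_trans _ (sub1G N)) // subG1.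
by apply/eqP/commG1P; rewrite subsetIr.
Qed.

(** * Chief factors in the supersoluble hypercentre *)

(** In a normal series of E with cyclic factors, take the first term B that
    meets V non-trivially: V :&: B meets the preceding term trivially, so it
    embeds in a cyclic factor. *)
Lemma supersoluble_cyclic_normal (gT : finGroupType) (E V : {group gT}) :
    supersoluble E -> V <| E -> V :!=: 1 ->
  exists W : {group gT}, [/\ W <| E, W \subset V, W :!=: 1 & cyclic W].
Proof.
case/connectP=> s; have: V :&: 1%G = 1 by rewrite (setIidPr (sub1G V)).
elim: s 1%G => [|B s IHs] A /= tiVA => [_ defE nsVE | ].
  by rewrite -tiVA -defE (setIidPl (normal_sub nsVE)) eqxx.
case/andP=> /and4P[nsAE nsBE sAB cycBA] pathBs defE nsVE ntV.
have [tiVB | ntVB] := eqVneq (V :&: B) 1; first exact: IHs tiVB pathBs defE nsVE ntV.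
exists (V :&: B)%G; split; rewrite ?subsetIl ?normalI //=.
have nAVB: V :&: B \subset 'N(A).
  by rewrite (subset_trans _ (normal_norm nsAE)) // subIset // normal_sub.
have tiAVB: A :&: (V :&: B) = 1.
  by apply/trivgP; rewrite /= setIC -tiVA setSI ?subsetIl.
rewrite (isog_cyclic (quotient_isog nAVB tiAVB)).
by apply: cyclicS cycBA; rewrite quotientS ?subsetIr.
Qed.

(** A cyclic normal subgroup of the semidirect product inside the copy of
    H / K is invariant under G / K, because that product realises conjugation;
    by minimality it is the whole of H / K. *)
Lemma U_central_cyclic (gT : finGroupType) (G H K : {group gT}) :
  chief_factor G K H -> U_central G H K -> cyclic (H / K).
Proof.
move=> chHK ssE; have [/maxgroupp/andP[/andP[sKH _] nKG] nsHG] := andP chHK.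
have minHK := chief_factor_minnormal chHK.
have nsKG: K <| G by rewrite /normal (subset_trans sKH (normal_sub nsHG)).
have [sdE iso1 iso2] := factor_sdprodE nsKG nsHG.
set f := sdpair1 _ in sdE iso1; set h := sdpair2 _ in sdE iso2.
have [ntHK nHKG] := andP (mingroupp minHK).
have [nsVE _ _ _ _] := sdprod_context sdE.
have injf := injm_sdpair1 (factor_act G H K).
have sHKd := factor_sub_range G H K.
have sGd := factor_sub_dom H nsKG.
have ntV: f @* (H / K) != 1 by rewrite morphim_injm_eq1.
have [W [nsWE sWV ntW cycW]] := supersoluble_cyclic_normal ssE nsVE ntV.
pose W0 := (f @*^-1 W :&: (H / K))%G.
have fW0: f @* W0 = W.
  by rewrite injmI ?morphpreK ?(subset_trans sWV) ?morphimS // (setIidPl sWV).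
have nW0G: G / K \subset 'N(W0).
  apply/subsetP=> _ /morphimP[g nKg Gg ->].
  rewrite inE; apply/subsetP=> _ /imsetP[x /setIP[Wx HKx] ->].
  have /morphimP[y nKy Hy def_x] := HKx.
  have Dx: x \in 'C_(|('J / K)%gact)(cent_factor G H K) := subsetP sHKd x HKx.
  have GCg: coset (cent_factor G H K) g \in G / cent_factor G H K.
    exact: mem_quotient.
  have defxg: factor_act G H K x (coset (cent_factor G H K) g) = x ^ coset K g.
    by rewrite def_x factor_actE // morphJ.
  have HKxg: x ^ coset K g \in H / K.
    by rewrite memJ_norm // (subsetP nHKG) ?mem_quotient.
  rewrite inE HKxg andbT; apply/morphpreP; split; first exact: subsetP sHKd _ HKxg.
  have := sdpair_act (factor_act G H K) Dx (subsetP sGd _ GCg).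
  rewrite [factor_act _ _ _ _ _]defxg => def_fxg.
  apply: (eq_ind_r (fun z => z \in W)) def_fxg; rewrite memJ_norm.
    by have [_ ] := morphpreP Wx.
  apply: subsetP (normal_norm nsWE) _ _; apply: subsetP (joing_subr _ _) _ _.
  exact: mem_morphim (subsetP sGd _ GCg) GCg.
have sW0: W0 \subset H / K by apply: subsetIr.
have ntW0: W0 :!=: 1.
  by rewrite -(morphim_injm_eq1 injf) ?fW0 // (subset_trans sW0).
have <- : W0 :=: H / K by have [_ minH] := mingroupP minHK; apply: minH; rewrite ?ntW0.
by rewrite -(injm_cyclic injf) ?(subset_trans sW0) // fW0.
Qed.

(** A Jordan-Hoelder argument: N avoids Y, so it is isomorphic to the
    factor (N <*> Y :&: X) / (Y :&: X), which is a chief factor of G below X. *)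
Lemma minnormal_join_cyclic (gT : finGroupType) (G N X Y : {group gT}) :
    X <| G -> Y <| G -> U_hypercentral G X -> minnormal N G ->
    N \subset X <*> Y -> ~~ (N \subset Y) ->
  cyclic N.
Proof.
move=> nsXG nsYG hyX minN sNXY nsNY.
have [/andP[ntN nNG] minNG] := mingroupP minN.
have nYG := normal_norm nsYG; have nXG := normal_norm nsXG.
have sNG: N \subset G.
  by rewrite (subset_trans sNXY) // join_subG !normal_sub.
have nYN: N \subset 'N(Y) := subset_trans sNG nYG.
have minI (D : {group gT}) : G \subset 'N(D) -> (N \subset D) || (N :&: D == 1).
  move=> nDG; case: (eqVneq (N :&: D) 1) => [|ntND]; first by rewrite orbT.
  by rewrite orbF; apply/setIidPl/minNG; rewrite ?subsetIl // ntND normsI.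
have tiNY: N :&: Y = 1 by have := minI Y nYG; rewrite (negPf nsNY) => /eqP.
pose A := (N <*> Y :&: X)%G; pose B := (Y :&: X)%G.
have defNY: Y * A = N <*> Y.
  rewrite /= setIC group_modl ?joing_subr // -norm_joinEr ?(subset_trans (normal_sub nsXG)) //.
  by apply/setIidPr; rewrite join_subG /= joing_subl joingC sNXY.
have sBA: B \subset A by rewrite setSI ?joing_subr.
have nAG: G \subset 'N(A) by rewrite normsI ?normsY.
have nBG: G \subset 'N(B) by rewrite normsI.
have sAG: A \subset G by rewrite subIset // (normal_sub nsXG) orbT.
have chAB: chief_factor G B A.
  rewrite /chief_factor /normal sAG nAG !andbT.
  apply/maxgroupP; split.
    rewrite nBG andbT properE sBA /=; apply: contra nsNY => sAB.
    have sAY: A \subset Y := subset_trans sAB (subsetIl _ _).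
    by rewrite -(mulGSid sAY) defNY joing_subl.
  move=> C /andP[prCA nCG] sBC; have [sCA not_sAC] := andP prCA.
  have nYC: C \subset 'N(Y) by rewrite (subset_trans sCA) ?(subset_trans sAG).
  (* By minimality of N, either N lies in Y C, and C = A by Dedekind's law, or
     N meets Y C trivially, and C = B. *)
  have /minI/orP[sNYC|/eqP tiN] : G \subset 'N(Y <*> C) by rewrite normsY.
    case/negP: not_sAC.
    have /setIidPl <-: A \subset Y <*> C.
      by rewrite subIset // join_subG sNYC joing_subl.
    rewrite (norm_joinEr nYC) -group_modr // mul_subG //.
    by apply: subset_trans sBC; rewrite setIC setIS ?subsetIr.
  apply/eqP; rewrite eqEsubset sBC andbT subsetI (subset_trans sCA (subsetIr _ _)) andbT.
  (* C lies in Y N, and Dedekind's law gives Y C = Y (N :&: Y C) = Y. *)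
  rewrite -(mul1g Y) -tiN setIC group_modr ?joing_subl //.
  rewrite subsetI joing_subr -norm_joinEl //.
  exact: subset_trans sCA (subsetIl _ _).
have /forallP/(_ B)/forallP/(_ A)/implyP := hyX.
rewrite chAB subsetIr => /(_ isT) /(U_central_cyclic chAB).
have tiYN: Y :&: N = 1 by rewrite setIC.
have defNbar: N / Y = A / Y by rewrite -(quotientYidr nYN) -defNY quotientMidl.
have nYA : A \subset 'N(Y) by rewrite (subset_trans sAG).
rewrite (isog_cyclic (quotient_isog nYN tiYN)) /= defNbar.
rewrite -(isog_cyclic (second_isog nYA)) (_ : Y :&: A = B) //.
by apply/setP=> x; rewrite !inE; case Yx: (x \in Y); rewrite // mem_gen // inE Yx orbT.
Qed.

(** The definition of the hypercentre only constrains the chief factors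
    below each of its generating normal subgroups. A minimal normal subgroup
    of G inside their product is reached by adding the generators one by one. *)
Lemma minnormal_hypercenter_cyclic (gT : finGroupType) (G N : {group gT}) :
  minnormal N G -> N \subset U_hypercenter G -> cyclic N.
Proof.
move=> minN; pose P (Z : {group gT}) := Z <| G /\ (N \subset Z -> cyclic N).
suff [_ ]: P (U_hypercenter G) by [].
apply: (big_rec P) => [|X Y].
  split; first exact: normal1.
  by move/trivgP=> N1; rewrite N1 cyclic1.
case/andP=> nsXG hyX [nsYG cycY]; split.
  exact: normalY.
move=> sN; case: (boolP (N \subset Y)) => [/cycY // | ].
exact: (minnormal_join_cyclic nsXG nsYG hyX minN sN).
Qed.

Lemma U_hypercenter_normal (gT : finGroupType) (G : {group gT}) : U_hypercenter G <| G.
Proof.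
rewrite /U_hypercenter; elim/big_rec: _ => [|X Y /andP[nsXG _]]; first exact: normal1.
exact: normalY.
Qed.

(** * Normal q-subgroups with U_s-quasinormal maximal subgroups *)

(** M T R is a group whose q-part is that of M T, too small for it to contain
    P because #|P T| = q #|M T|. Hence M = P :&: M T R, which R normalises. *)
Lemma s_permutable_norm_maximal (gT : finGroupType) (G P M T R : {group gT}) (q r : nat) :
    prime q -> P <| G -> q.-group P -> maximal M P -> T <| G -> P :&: T \subset M ->
    s_permutable (M * T) G -> prime r -> r != q -> r.-Sylow(G) R ->
  R \subset 'N(M).
Proof.
move=> q_pr nsPG qP maxM nsTG sPTM [_ permMT] r_pr neq_rq sylR.
have [sMP _] := andP (maxgroupp maxM).
have nTG := normal_norm nsTG; have nPG := normal_norm nsPG.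
have nTP: P \subset 'N(T) := subset_trans (normal_sub nsPG) nTG.
have nTM: M \subset 'N(T) := subset_trans sMP nTP.
have sRG := pHall_sub sylR.
have permMTR: commute (M <*> T) R by rewrite norm_joinEl //; apply: permMT sylR.
pose A := (M <*> T <*> R)%G.
have defA: A :=: (M <*> T) * R := comm_joingE permMTR.
have sMTA: M <*> T \subset A by rewrite /= joing_subl.
have sMA: M \subset A := subset_trans (joing_subl _ _) sMTA.
have not_sPA: ~~ (P \subset A).
  apply/negP=> sPA.
  have sPTA: P <*> T \subset A.
    by rewrite join_subG sPA (subset_trans (joing_subr M T) sMTA).
  (* R is an r-group, so it contributes nothing to the q-part of #|A|. *)
  have: logn q #|P <*> T| <= logn q #|M <*> T|.
    apply: leq_trans (dvdn_leq_log q (cardG_gt0 A) (cardSg sPTA)) _.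
    have: #|A| %| #|M <*> T| * #|R| by rewrite mul_cardG -defA dvdn_mulr.
    move/(dvdn_leq_log q); rewrite muln_gt0 !cardG_gt0 lognM // => /(_ isT).
    rewrite (card_Hall sylR) p_part lognX [logn q r]logn_prime // eq_sym (negPf neq_rq).
    by rewrite muln0 addn0.
  have oPT: #|P <*> T| = (q * #|M <*> T|)%N.
    apply/eqP; rewrite -(eqn_pmul2r (cardG_gt0 (P :&: T))) -mulnA.
    have defI: P :&: T = M :&: T.
      by apply/eqP; rewrite eqEsubset subsetI sPTM subsetIr setSI.
    have oPTI: (#|P <*> T| * #|P :&: T| = #|P| * #|T|)%N.
      by rewrite norm_joinEl // mul_cardG.
    have oMTI: (#|M <*> T| * #|P :&: T| = #|M| * #|T|)%N.
      by rewrite defI norm_joinEl // mul_cardG.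
    by rewrite oPTI oMTI mulnA -(p_maximal_index qP maxM) [(_ * #|M|)%N]mulnC Lagrange.
  by rewrite oPT lognM ?cardG_gt0 ?prime_gt0 // logn_prime // eqxx ltnn.
have defM: A :&: P = M.
  have /maximal_eqP[_ maxP]: maximal_eq M P by rewrite /maximal_eq maxM orbT.
  have sMAP: M \subset (A :&: P)%G by rewrite subsetI sMA.
  have [// | defP] := maxP _ sMAP (subsetIr _ _).
  by case/negP: not_sPA; apply/setIidPr.
have sRA: R \subset A by rewrite joing_subr.
by rewrite -defM normsI ?(subset_trans sRG nPG) ?(subset_trans sRA (normG A)).
Qed.

(** A Sylow q-subgroup Q of G contains P, so it normalises a subgroup of
    index q between N and N0; as P / 'Phi(P) is elementary abelian, this
    subgroup is the trace on N0 of a maximal subgroup M of P. If other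
    information shows that M :&: N0 is normalised by the Sylow r-subgroups for
    r != q, it is normal in G. *)
Lemma exists_Sylow_stable_hyperplane (gT : finGroupType) (G P N N0 : {group gT}) (q : nat) :
    q.-group P -> P <| G -> N <| G -> N0 <| G ->
    'Phi(P) \subset N -> N \proper N0 -> N0 \subset P ->
  exists Q M : {group gT},
    [/\ q.-Sylow(G) Q, maximal M P, N \subset M, Q \subset 'N(M :&: N0)
      & #|N0 : M :&: N0| = q].
Proof.
move=> qP nsPG nsNG nsN0G sPhiN prNN0 sN0P.
have [Q sylQ] := Sylow_exists q G.
have [sQG qQ _] := and3P sylQ.
have sPQ : P \subset Q by rewrite (normal_sub_max_pgroup (Hall_max sylQ)).
have [sNN0 _] := andP prNN0.
have nsNQ : N <| Q by apply: normalS sQG nsNG; rewrite (subset_trans sNN0) ?(subset_trans sN0P).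
have nsN0Q : N0 <| Q by apply: normalS sQG nsN0G; rewrite (subset_trans sN0P).
have nNN0 : N0 \subset 'N(N) := subset_trans (normal_sub nsN0Q) (normal_norm nsNQ).
have qN0 : q.-group N0 := pgroupS sN0P qP.
have ntN0N : (N0 / N)%G :!=: 1 by rewrite -subG1 quotient_sub1 // proper_subn.
have [q_pr _ [n oN0N]] := pgroup_pdiv (quotient_pgroup N qN0) ntN0N.
have [|M1 [sM1 nsM1Q oM1]] :=
  @normal_pgroup q _ n (Q / N)%G (N0 / N)%G (quotient_pgroup N qQ) (quotient_normal N nsN0Q).
  by rewrite oN0N pfactorK.
have [M0 defM1 sNM0 nsM0Q] := inv_quotientN nsNQ nsM1Q.
have sM0N0 : M0 \subset N0.
  have nNM0 : M0 \subset 'N(N) := subset_trans (normal_sub nsM0Q) (normal_norm nsNQ).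
  by rewrite -(quotientSGK nNM0 sNN0) -defM1.
have iM0 : #|N0 : M0| = q.
  rewrite -(index_quotient_eq (H := N)) ?subIset ?sNM0 ?orbT // -divgS ?quotientS //.
  by rewrite /= -defM1 oN0N oM1 expnS mulnK // expn_gt0 prime_gt0.
have nM0P : P \subset 'N(M0) by rewrite (subset_trans sPQ) ?normal_norm.
have nsM0N0 : M0 <| N0 by rewrite /normal sM0N0 (subset_trans sN0P).
have abPM0 : q.-abelem (P / M0).
  rewrite -trivg_Phi ?quotient_pgroup // -(quotient_Phi qP) // -subG1.
  by rewrite quotient_sub1 ?(subset_trans (Phi_sub P) nM0P) ?(subset_trans sPhiN).
have [B1 defPM0] := abelem_split_dprod abPM0 (quotientS M0 sN0P).
have [_ defPbar _ tiN0B1] := dprodP defPM0.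
have sB1P : B1 \subset P / M0 by rewrite -defPbar mulG_subr.
have nsM0P : M0 <| P by rewrite /normal (subset_trans sM0N0).
have [M defM sM0M sMP] := inv_quotientS nsM0P sB1P.
have defI : M :&: N0 = M0.
  apply/eqP; rewrite eqEsubset subsetI sM0M sM0N0 !andbT.
  have nM0I : M :&: N0 \subset 'N(M0) by rewrite subIset // (subset_trans sMP).
  rewrite -quotient_sub1 //; apply: subset_trans (quotientI _ _ _) _.
  by rewrite -defM setIC tiN0B1.
have iM : #|P : M| = q.
  rewrite -(index_quotient_eq (H := M0)) ?subIset ?sM0M ?orbT //.
  rewrite -divgS ?quotientS // -(dprod_card defPM0) /= -defM mulnK //.
  by rewrite card_quotient ?iM0 // (subset_trans sN0P).
exists Q; exists M; rewrite defI; split=> //.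
- by rewrite p_index_maximal // iM.
- exact: subset_trans sM0M.
exact: normal_norm.
Qed.

(** The hypothesis on C says that every normal subgroup of G between N and P,
    other than N, contains N0. Let M be the maximal subgroup of P given by
    [exists_Sylow_stable_hyperplane]: its core is N. Either M :&: N0 = N, and
    N has index q in N0 by the choice of M, or N0 / N lies in the
    hypercentre, and is cyclic and elementary abelian. *)
Lemma unique_minnormal_index (gT : finGroupType) (G P N N0 : {group gT}) (q : nat) :
    prime q -> q.-group P -> P <| G -> N <| G -> N0 <| G ->
    'Phi(P) \subset N -> N \proper N0 -> N0 \subset P ->
    (forall C : {group gT}, C <| G -> N \subset C -> C \subset P ->
       ~~ (N0 \subset C) -> C :=: N) ->
    (forall M : {group gT}, maximal M P -> Us_quasinormal M G) ->
  #|N0 : N| = q.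
Proof.
move=> q_pr qP nsPG nsNG nsN0G sPhiN prNN0 sN0P minN0 qnP.
have [Q [M [sylQ maxM sNM nM0Q iM0]]] :=
  exists_Sylow_stable_hyperplane qP nsPG nsNG nsN0G sPhiN prNN0 sN0P.
have [_ [T [nsTG permMT hypMT]]] := qnP M maxM.
have [sMP _] := andP (maxgroupp maxM).
have sNN0 := proper_sub prNN0; have sNP := subset_trans sNN0 sN0P.
have nNG := normal_norm nsNG.
have nNP : P \subset 'N(N) := subset_trans (normal_sub nsPG) nNG.
have nNN0 : N0 \subset 'N(N) := subset_trans sN0P nNP.
have not_sN0M : ~~ (N0 \subset M).
  apply: contraL (prime_gt1 q_pr) => /setIidPr sN0M.
  by rewrite -iM0 sN0M indexgg.
suff [defN | cycN0] : M :&: N0 \subset N \/ cyclic (N0 / N).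
- rewrite -iM0; suff -> : M :&: N0 = N by [].
  by apply/eqP; rewrite eqEsubset defN subsetI sNM sNN0.
- have abN0 : q.-abelem (N0 / N).
    have abP : q.-abelem (P / N).
      rewrite -trivg_Phi ?quotient_pgroup // -(quotient_Phi qP) // -subG1.
      by rewrite quotient_sub1 ?(subset_trans (Phi_sub P) nNP).
    exact: abelemS (quotientS N sN0P) abP.
  rewrite -card_quotient // (cyclic_abelem_prime abN0) //.
  by rewrite -subG1 quotient_sub1 // proper_subn.
have gcoreN : gcore M G = N.
  have sKM := gcore_sub M G.
  apply: (minN0 (gcore_group M G)).
  - by rewrite gcore_normal // (subset_trans sMP (normal_sub nsPG)).
  - exact: gcore_max.
  - exact: subset_trans sKM sMP.
  by apply: contra not_sN0M => /subset_trans; apply.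
rewrite gcoreN in hypMT.
have [sPTM | not_sPTM] := boolP (P :&: T \subset M).
  (* The normaliser of M :&: N0 contains a Sylow r-subgroup of G for each r:
     Q when r = q, and otherwise any one, by s-permutability of M T. *)
  left; suff nsIG : M :&: N0 <| G.
    rewrite (minN0 (M :&: N0)%G) //= ?subsetI ?sNM ?sNN0 //.
      by rewrite subIset ?sMP.
    by rewrite (negPf not_sN0M).
  have sIG : M :&: N0 \subset G by rewrite subIset // (normal_sub nsN0G) orbT.
  rewrite /normal sIG; apply/setIidPl.
  apply: (@group_eq_Sylow_sub _ 'N_G(M :&: N0) G (subsetIl _ _)) => r r_pr.
  have [-> | neq_rq] := eqVneq r q.
    by exists Q; rewrite // subsetI nM0Q (pHall_sub sylQ).
  have [R sylR] := Sylow_exists r G.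
  exists R; rewrite // subsetI (pHall_sub sylR) /= normsI //.
    exact: (s_permutable_norm_maximal q_pr nsPG qP maxM nsTG sPTM permMT r_pr neq_rq sylR).
  exact: subset_trans (pHall_sub sylR) (normal_norm nsN0G).
have [sMTN | not_sMTN] := boolP (M :&: T \subset N).
  (* D contains N0 but meets M in N (P :&: T :&: M) = N. *)
  left; pose D := (N <*> (P :&: T))%G.
  have nNPT : P :&: T \subset 'N(N) by rewrite subIset ?nNP.
  have nsDG : D <| G by rewrite normalY ?normalI.
  have sND : N \subset D by rewrite joing_subl.
  have sPTD : P :&: T \subset D by rewrite joing_subr.
  have sDP : D \subset P by rewrite join_subG sNP subsetIl.
  have sN0D : N0 \subset D.
    apply: contraR not_sPTM => not_sN0D; apply: subset_trans sPTD _.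
    by rewrite (minN0 D).
  apply: subset_trans (setIS M sN0D) _.
  rewrite /= norm_joinEr // setIC -group_modl // mul_subG //.
  by apply: subset_trans sMTN; rewrite setIAC setSI ?subsetIr.
right.
(* M :&: T is not inside N, so P / N meets the hypercentre of G / N
   non-trivially, and this intersection contains N0 / N. *)
pose Z := (U_hypercenter (G / N) :&: P / N)%G.
have nsZG : Z <| G / N by rewrite normalI ?U_hypercenter_normal ?quotient_normal.
have [C defC sNC nsCG] := inv_quotientN nsNG nsZG.
have sCP : C \subset P.
  by rewrite -(quotientSGK (subset_trans (normal_sub nsCG) nNG) sNP) -defC subsetIr.
have sN0C : N0 \subset C.
  apply: contraR not_sMTN => not_sN0C.
  have defCN := minN0 C nsCG sNC sCP not_sN0C.
  have nNMT : M :&: T \subset 'N(N) by rewrite subIset // (subset_trans sMP).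
  have trZ : Z :=: 1 by rewrite defC defCN // trivg_quotient.
  rewrite -quotient_sub1 // -trZ subsetI quotientS ?subIset ?sMP // andbT.
  by apply: subset_trans hypMT; rewrite quotientS ?mulG_subl.
apply: (@minnormal_hypercenter_cyclic _ (G / N)).
  apply/mingroupP; split.
    by rewrite quotient_norms ?normal_norm // -subG1 quotient_sub1 // proper_subn.
  move=> Y /andP[ntY nYG] sYN0.
  have nsYG : Y <| G / N.
    by rewrite /normal nYG (subset_trans sYN0) ?quotientS ?normal_sub.
  have [B defY sNB nsBG] := inv_quotientN nsNG nsYG.
  have nNB := subset_trans (normal_sub nsBG) nNG.
  have sBN0 : B \subset N0 by rewrite -(quotientSGK nNB sNN0) -defY.
  have [sN0B | not_sN0B] := boolP (N0 \subset B).
    by apply/eqP; rewrite eqEsubset sYN0 defY quotientS.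
  case/negP: ntY; rewrite defY (minN0 B nsBG sNB _ not_sN0B) ?trivg_quotient //.
  exact: subset_trans sBN0 sN0P.
by apply: subset_trans (quotientS N sN0C) _; rewrite -defC subsetIl.
Qed.

(** The condition on g is stated through sections of order q so that it
    covers both the elements of the derived group of G, for every q, and all
    q'-elements of G when #|G| is coprime to q - 1. *)
Lemma Us_quasinormal_coprime_cent (gT : finGroupType) (G P : {group gT}) (q : nat) (g : gT) :
    prime q -> q.-group P -> P <| G ->
    (forall M : {group gT}, maximal M P -> Us_quasinormal M G) ->
    g \in G -> q^'.-elt g ->
    (forall A B : {group gT}, A <| G -> B <| G -> A \subset B -> #|B : A| = q ->
       [~: B, <[g]>] \subset A) ->
  g \in 'C(P).
Proof.
move=> q_pr qP nsPG qnP Gg q'g cent_q.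
have nG : forall N : {group gT}, N <| G -> <[g]> \subset 'N(N).
  by move=> N nsNG; rewrite cycle_subG (subsetP (normal_norm nsNG)).
have nPN : forall N : {group gT}, N <| G -> N \subset P -> N <| P.
  by move=> N nsNG sNP; apply: normalS nsNG => //; apply: normal_sub.
have coPg : coprime #|P| #|<[g]>| by apply: pnat_coprime qP q'g.
have solP := pgroup_sol qP.
rewrite -cycle_subG (coprime_cent_Phi (nG _ nsPG)) //.
apply/idPn=> ncPhi.
pose bad (N : {group gT}) :=
  [&& N <| G, 'Phi(P) \subset N, N \subset P & ~~ ([~: P, <[g]>] \subset N)].
have badPhi : bad ('Phi(P))%G by rewrite /bad gFnormal_trans // subxx Phi_sub.
have [N /maxgroupP[/and4P[nsNG sPhiN sNP ncN] maxN] _] := maxgroup_exists badPhi.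
have prNP : N \proper P.
  rewrite properEneq sNP andbT; apply: contra ncN => /eqP->.
  by rewrite commg_subl nG.
have [|N0 /mingroupP[/andP[prNN0 nsN0G] minN0] sN0P] :=
  @mingroup_exists _ [pred K : {group gT} | (N \proper K) && (K <| G)] P.
  by rewrite /= prNP.
(* This gives the uniqueness of N0: if C is normal in G and N < C <= P, then
   C :&: N0 contains [P, g], so it is not N, and it is N0 by minimality. *)
have good (C : {group gT}) : C <| G -> N \proper C -> C \subset P -> [~: P, <[g]>] \subset C.
  move=> nsCG prNC sCP; apply/idPn=> ncC; have sNC := proper_sub prNC.
  case/negP: (proper_subn prNC); rewrite (maxN C) // /bad nsCG sCP ncC !andbT.
  exact: subset_trans sPhiN sNC.
case/negP: (ncN); have sNN0 := proper_sub prNN0.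
apply: (coprime_comm_trans (nG _ nsPG) coPg solP (N0 := N0)); rewrite ?nG ?nPN ?good //.
apply: cent_q => //; apply: (unique_minnormal_index q_pr qP nsPG nsNG nsN0G) => //.
move=> C nsCG sNC sCP not_sN0C; apply/eqP; rewrite eq_sym eqEproper sNC /=.
apply: contra not_sN0C => prNC; apply/setIidPr; apply: minN0; rewrite ?subsetIr //=.
rewrite normalI // andbT properE subsetI sNC sNN0 /=; apply: contra ncN => sIN.
by apply: subset_trans sIN; rewrite subsetI !good.
Qed.

(** * Sections of order q and p-nilpotence *)

(** G acts on B / A through a subgroup of its automorphism group, which is
    abelian of order #|B : A| - 1. *)
Lemma comm_prime_section (gT : finGroupType) (G A B : {group gT}) :
    A <| G -> B <| G -> A \subset B -> prime #|B : A| ->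
  [~: B, G^`(1)] \subset A
    /\ (coprime #|G| (#|B : A|).-1 -> [~: B, G] \subset A).
Proof.
move=> nsAG nsBG sAB pr_iBA; have nAG := normal_norm nsAG.
have nAB := subset_trans (normal_sub nsBG) nAG.
have oBA : #|B / A| = #|B : A| by rewrite card_quotient.
have cycBA : cyclic (B / A) by rewrite prime_cyclic ?oBA.
pose f := conj_aut_morphism (B / A)%G.
have nBA : G / A \subset 'N(B / A) by rewrite quotient_norms ?normal_norm.
have kerP (X : {group gT}) : X \subset G -> f @* (X / A) \subset [1] -> [~: B, X] \subset A.
  move=> sXG fX1; rewrite commGC -quotient_cents2 ?(subset_trans sXG) //.
  have nBX : X / A \subset 'N(B / A) := subset_trans (quotientS A sXG) nBA.
  by rewrite -(ker_conj_aut (B / A)%G) ker_trivg_morphim nBX.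
split.
  apply: kerP; first exact: der_sub.
  rewrite quotient_der // morphim_der // subG1; apply/eqP/derG1P.
  exact: abelianS (Aut_conj_aut _ _) (Aut_cyclic_abelian cycBA).
move=> coG; apply: kerP => //.
rewrite subG1 trivg_card1 -dvdn1 -(eqP coG) dvdn_gcd.
rewrite (dvdn_trans (dvdn_morphim _ _)) ?dvdn_quotient //=.
have <- : #|Aut (B / A)| = #|B : A|.-1.
  by rewrite card_Aut_cyclic // oBA totient_prime.
by rewrite cardSg ?Aut_conj_aut.
Qed.

(** Pulling the normal p-complement back to G leaves conditions on indices
    only; these are unchanged modulo a normal subgroup of G contained in N. *)
Lemma p_nilpotent_quotient (gT : finGroupType) (p : nat) (G N : {group gT}) :
    N <| G -> p_nilpotent p (G / N) ->
  exists K : {group gT},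
    [/\ K <| G, N \subset K, p.-nat #|G : K| & p^'.-nat #|K : N|].
Proof.
move=> nsNG /existsP[Kbar /andP[nsKb hallKb]].
have [K defK sNK nsKG] := inv_quotientN nsNG nsKb.
have nNK := subset_trans (normal_sub nsKG) (normal_norm nsNG).
have [_ p'K pGK] := and3P hallKb.
exists K; split=> //.
  move: pGK; rewrite pnatNK defK index_quotient_eq ?(normal_sub nsKG) ?(normal_norm nsNG) //.
  by rewrite subIset // sNK orbT.
by rewrite -card_quotient // -defK.
Qed.

(** 'O_p(N) is a normal Sylow p-subgroup of K. A complement K1 given by the
    Schur-Zassenhaus theorem is a p'-group, so it centralises 'O_p(N) and is
    normal, hence characteristic, in K; it is the normal p-complement of G. *)
Lemma p_nilpotent_nilpotent_ext (gT : finGroupType) (p : nat) (G K N : {group gT}) :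
    K <| G -> N \subset K -> p.-nat #|G : K| -> p^'.-nat #|K : N| ->
    N <| G -> nilpotent N ->
    (forall g, g \in G -> p^'.-elt g -> g \in 'C('O_p(N))) ->
  p_nilpotent p G.
Proof.
move=> nsKG sNK pGK p'KN nsNG nilN cNp; set S := ('O_p(N))%G.
have [sSN pS p'NS] := and3P (nilpotent_pcore_Hall p nilN).
have sSK : S \subset K := subset_trans sSN sNK.
have nsSK : S <| K.
  by apply: normalS sSK (normal_sub nsKG) _; apply: gFnormal_trans.
have hallS : p.-Hall(K) S.
  by rewrite /pHall sSK pS -(Lagrange_index sNK sSN) pnatM p'KN.
have /splitsP[K1 complK1] := SchurZassenhaus_split (pHall_Hall hallS) nsSK.
have hallK1 : p^'.-Hall(K) K1 by rewrite -(compl_pHall K1 hallS).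
have [sK1K p'K1 pKK1] := and3P hallK1.
have [_ defK] := complP complK1.
have cSK1 : K1 \subset 'C(S).
  apply/subsetP=> x K1x; apply: cNp; last exact: mem_p_elt p'K1 K1x.
  by rewrite (subsetP (normal_sub nsKG)) ?(subsetP sK1K).
have nsK1K : K1 <| K.
  by rewrite /normal sK1K -defK mul_subG ?normG // cents_norm // centsC.
apply/existsP; exists K1; apply/andP; split.
  by rewrite -(normal_Hall_pcore hallK1 nsK1K) gFnormal_trans.
rewrite /pHall (subset_trans sK1K) ?normal_sub // p'K1 /=.
by rewrite -(Lagrange_index (normal_sub nsKG) sK1K) pnatM pKK1 pnatNK pGK.
Qed.

(** A Sylow r-subgroup R of L centralises 'O_q(H) for all q != r, hence lies
    in the subgroup Y of elements of L centralising D = 'O_r^'('F(H)). An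
    r'-element of Y also centralises 'O_r(H), so it centralises 'F(H), lies in
    'F(H) and then in D. Thus Y is an r-group modulo the central subgroup
    D :&: Y; it is nilpotent, and R lies in 'F(H). *)
Lemma sub_Fitting_cent_pcore (gT : finGroupType) (H L : {group gT}) :
    solvable H -> L <| H ->
    (forall q g, prime q -> g \in L -> q^'.-elt g -> g \in 'C('O_q(H))) ->
  L \subset 'F(H).
Proof.
move=> solH nsLH cL; have sLH := normal_sub nsLH; have nilF := Fitting_nil H.
apply/setIidPl; apply: group_eq_Sylow_sub (subsetIl L _) _ => r r_pr.
have [R sylR] := Sylow_exists r L; have [sRL rR _] := and3P sylR.
exists R; rewrite // subsetI sRL /=.
pose D := ('O_r^'('F(H)))%G.
have nsDH : D <| H by rewrite !gFnormal_trans.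
pose Y := ('C_H(D) :&: L)%G.
have nsYH : Y <| H.
  have := subcent_normal H D; rewrite (setIidPl (normal_norm nsDH)) => nsCH.
  exact: normalI.
have sRY : R \subset Y.
  rewrite !subsetI sRL (subset_trans sRL) //= andbT centsC; apply/setIidPl.
  apply: group_eq_Sylow_sub (subsetIl D _) _ => q q_pr; exists ('O_q(D))%G.
    by rewrite nilpotent_pcore_Hall // (nilpotentS (pcore_sub _ _)).
  rewrite subsetI pcore_sub centsC; apply/subsetP=> x Rx.
  have [-> | neq_qr] := eqVneq q r.
    suff -> : ('O_r(D))%G :=: 1 by apply/centP=> y /set1P->; apply: commute1.
    apply: card1_trivg; apply: (pnat_1 (pcore_pgroup r D)).
    exact: pgroupS (pcore_sub r D) (pcore_pgroup _ _).
  have: x \in 'C('O_q(H)).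
    apply: cL => //; first exact: subsetP sRL x Rx.
    apply: sub_p_elt (mem_p_elt rR Rx) => i; rewrite !inE => /eqP->.
    by rewrite eq_sym.
  apply: subsetP; apply: centS; apply: pcore_max (pcore_pgroup q D) _.
  exact: gFnormal_trans.
apply: (subset_trans sRY); apply: (Fitting_max nsYH).
pose Z := (D :&: Y)%G.
apply: (@nilpotent_central_ext _ Z).
  rewrite subsetI subsetIr /= (subset_trans (subsetIl _ _)) // centsC.
  exact: subset_trans (subsetIl _ _) (subsetIr _ _).
apply: (@pgroup_nil _ r); apply/pgroupP=> t t_pr /(Cauchy t_pr)[xb].
case/morphimP=> x nZx Yx -> ox.
have Yx' : x.`_r^' \in Y by rewrite groupX.
have [/setIP[Hx' cDx'] Lx'] := setIP Yx'.
have defF := dprodW (nilpotent_pcoreC r nilF).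
have cFx' : x.`_r^' \in 'C('F(H)).
  rewrite -defF centM; apply/setIP; split=> //.
  by rewrite /= p_core_Fitting; apply: cL; rewrite ?p_elt_constt.
have Fx' : x.`_r^' \in 'F(H).
  by apply: subsetP (subcent_Fitting solH) _ _; rewrite inE Hx'.
have Zx' : x.`_r^' \in Z.
  rewrite inE Yx' andbT (mem_normal_Hall (nilpotent_pcore_Hall _ nilF)) ?p_elt_constt //.
  exact: gFnormal.
have nZxr : x.`_r \in 'N(Z) by rewrite groupX.
have : r.-elt (coset Z x).
  rewrite -(consttC r x) morphM ?groupX //= (coset_id Zx') mulg1.
  by rewrite morph_p_elt ?p_elt_constt.
by rewrite /p_elt ox pnatE.
Qed.

(** * The characterisation of p-nilpotence *)

Theorem theorem4p4 (gT : finGroupType) (G : {group gT}) (p : nat)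
    (p_pr : prime p) (p_dvd : p %| #|G|) (p_cop : coprime #|G| p.-1) :
  p_nilpotent p G <->
  exists H : {group gT},
    [/\ H <| G, solvable H, p_nilpotent p (G / H)
      & forall (q : nat) (P M : {group gT}),
          prime q -> q.-Sylow('F(H)) P -> maximal M P -> Us_quasinormal M G].
Proof.
split=> [/existsP[K /andP[nsKG hallK]] | [H [nsHG solH pnilGH qnH]]].
  exists 1%G; split; rewrite ?normal1 ?solvable1 //.
    apply/existsP; exists (K / 1)%G.
    by rewrite quotient_normal // quotient_pHall // norms1.
  move=> q P M _ sylP /maxgroupp/andP[_] /negP[].
  have /trivgP-> : P \subset [1]; last exact: sub1G.
  by rewrite (subset_trans (pHall_sub sylP)) // (subset_trans (Fitting_sub _)).
have nsFG : 'F(H) <| G by apply: gFnormal_trans.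
have nilF := Fitting_nil H.
have cent_pcore q g : prime q -> g \in G -> q^'.-elt g ->
    (forall A B : {group gT}, A <| G -> B <| G -> A \subset B -> #|B : A| = q ->
       [~: B, <[g]>] \subset A) ->
    g \in 'C('O_q(H)).
  move=> q_pr Gg q'g; apply: (Us_quasinormal_coprime_cent q_pr (pcore_pgroup q H)) => //.
    exact: gFnormal_trans.
  move=> M; apply: qnH q_pr _.
  by rewrite /= -p_core_Fitting nilpotent_pcore_Hall.
pose L := (H :&: G^`(1))%G.
have sLF : L \subset 'F(H).
  apply: sub_Fitting_cent_pcore solH _ _.
    by apply: normalS (subsetIl _ _) (normal_sub nsHG) _; rewrite normalI ?der_normal.
  move=> q g q_pr /setIP[_ G'g] q'g.
  apply: cent_pcore => // [|A B nsAG nsBG sAB iBA].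
    exact: subsetP (der_sub 1 G) g G'g.
  have [|cG' _] := comm_prime_section nsAG nsBG sAB; first by rewrite iBA.
  by apply: subset_trans cG'; rewrite commgS ?cycle_subG.
have cHG : [~: H, G] \subset 'F(H).
  apply: subset_trans sLF; rewrite subsetI commg_subl (normal_norm nsHG) /=.
  by rewrite derg1 commSg ?normal_sub.
have [K [nsKG sHK pGK p'KH]] := p_nilpotent_quotient nsHG pnilGH.
have nFG := normal_norm nsFG; have sKG := normal_sub nsKG.
have sFH := Fitting_sub H.
have sFK : 'F(H) \subset K := subset_trans sFH sHK.
have cHbar : H / 'F(H) \subset 'C(G / 'F(H)) by apply: quotient_cents2r.
have pnilGF : p_nilpotent p (G / 'F(H)).
  apply: (@p_nilpotent_nilpotent_ext _ p _ (K / 'F(H)) (H / 'F(H))).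
  - exact: quotient_normal.
  - exact: quotientS.
  - by rewrite index_quotient_eq // subIset // sFK orbT.
  - by rewrite index_quotient_eq ?(subset_trans sKG) // subIset // sFH orbT.
  - exact: quotient_normal.
  - apply: abelian_nil; apply: subset_trans cHbar _; apply: centS.
    by rewrite quotientS ?normal_sub.
  move=> x Gx _; apply: subsetP x Gx; rewrite centsC.
  exact: subset_trans (pcore_sub _ _) cHbar.
have [K1 [nsK1G sFK1 pGK1 p'K1F]] := p_nilpotent_quotient nsFG pnilGF.
apply: (p_nilpotent_nilpotent_ext nsK1G sFK1 pGK1 p'K1F nsFG nilF) => g Gg p'g.
rewrite /= p_core_Fitting; apply: cent_pcore => // A B nsAG nsBG sAB iBA.
have [|_ cG] := comm_prime_section nsAG nsBG sAB; first by rewrite iBA.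
by apply: subset_trans (cG _); rewrite ?iBA // commgS ?cycle_subG.
Qed.
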